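(* Let $G$ and $H$ be cospectral (simple, finite) graphs on $n$ vertices, and let $Gr$ be a finite group of order $t$. If $g\in Gr$ is such that the permutation matrix $P_g$ is symmetric, then the graphs $G_g$ and $H_g$ are cospectral.
   Context: Two graphs are cospectral if their adjacency matrices have the same multiset of eigenvalues. Let $Gr=(\{g_0,\dots,g_{t-1}\},* )$ be a group of order $t$. For $g\in Gr$, $P_g$ is the $t\times t$ permutation matrix, with rows and columns indexed by $0,\dots,t-1$, given by $P_g(a,b)=1$ if $g_a*g=g_b$ and $P_g(a,b)=0$ otherwise. For a simple graph $G$ with vertices $v_1,\dots,v_n$ and edge set $E$, let $\dot E=\{(i,j): i<j,\ \{v_i,v_j\}\in E\}$. A signature is a map $s:\dot E\to Gr$. The lift $G(s)$ is the graph on vertex set $V(G)\times\{0,\dots,t-1\}$ in which, for each $(i,j)\in\dot E$ and $a,b\in\{0,\dots,t-1\}$, the vertices $(v_i,a)$ and $(v_j,b)$ are adjacent if and only if $s(i,j)*g_a=g_b$; there are no other edges. For $g\in Gr$, $G_g$ denotes the lift $G(s)$ for the constant signature $s\equiv g$; $H_g$ is defined in the same way from $H$. *)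

(* Defs.v *)
From HB Require Import structures.
From mathcomp Require Import all_boot all_order all_fingroup all_algebra all_field.

Set Implicit Arguments.
Unset Strict Implicit.
Unset Printing Implicit Defensive.

Import GRing.Theory.
Local Open Scope ring_scope.

Record sgraph (T : finType) := SGraph {
  adj : rel T;
  adj_sym : symmetric adj;
  adj_irrefl : irreflexive adj
}.

(* The rows and columns follow the enumeration of [T]; another ordering of the
   vertices gives a similar matrix, hence the same spectrum. *)
Definition adjmx (T : finType) (G : sgraph T) : 'M[algC]_#|T| :=
  \matrix_(i, j) (adj G (enum_val i) (enum_val j))%:R.

(* The eigenvalues listed with their algebraic multiplicities, as the roots of
   the characteristic polynomial, which splits over [algC]; the list stands for
   a multiset and is meaningful only up to [perm_eq]. *)
Definition spectrum (m : nat) (A : 'M[algC]_m) : seq algC :=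
  sval (closed_field_poly_normal (char_poly A)).

Definition cospectral (T U : finType) (G : sgraph T) (H : sgraph U) : Prop :=
  perm_eq (spectrum (adjmx G)) (spectrum (adjmx H)).

Definition dotE (n : nat) (G : sgraph 'I_n) : {set 'I_n * 'I_n} :=
  [set p : 'I_n * 'I_n | (p.1 < p.2)%N && adj G p.1 p.2].

Definition signature (n : nat) (G : sgraph 'I_n) (Gr : finGroupType) : Type :=
  {p : 'I_n * 'I_n | p \in dotE G} -> Gr.

Section Lift.

(* [elt] lists the elements of the group as g_0, ..., g_(t-1). *)
Variables (Gr : finGroupType) (t : nat) (elt : 'I_t -> Gr).

(* Right multiplication by [g], whereas lifts use left multiplication. *)
Definition Pmx (g : Gr) : 'M[algC]_t :=
  \matrix_(a, b) ((elt a * g)%g == elt b)%:R.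

Variables (n : nat) (G : sgraph 'I_n).

(* The two disjuncts make the relation symmetric: [d] is the edge (i, j), i < j,
   below {x, y}, and the group element acts from the fibre of i to that of j. *)
Definition lift_adj (s : signature G Gr) : rel ('I_n * 'I_t) := fun x y =>
  [exists d : {p : 'I_n * 'I_n | p \in dotE G},
     ((val d == (x.1, y.1)) && ((s d * elt x.2)%g == elt y.2))
  || ((val d == (y.1, x.1)) && ((s d * elt y.2)%g == elt x.2))].

Lemma lift_adj_sym (s : signature G Gr) : symmetric (lift_adj s).
Proof. by move=> x y; apply: eq_existsb => d; rewrite orbC. Qed.

Lemma lift_adj_irrefl (s : signature G Gr) : irreflexive (lift_adj s).
Proof.
move=> x; apply/existsP => -[[p pE] /=]; rewrite orbb => /andP[/eqP Dp _].
by move: pE; rewrite inE Dp /= ltnn.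
Qed.

Definition glift (s : signature G Gr) : sgraph ('I_n * 'I_t)%type :=
  SGraph (lift_adj_sym s) (lift_adj_irrefl s).

Definition const_lift (g : Gr) : sgraph ('I_n * 'I_t)%type :=
  glift (fun=> g).

End Lift.

(* Main.v *)
Require Import Defs.
From mathcomp Require Import all_boot all_order all_fingroup all_algebra all_field.

Set Implicit Arguments.
Unset Strict Implicit.
Unset Printing Implicit Defensive.

Local Open Scope ring_scope.

Import GRing.Theory Num.Theory.

(** If P_g is symmetric then g is an involution, so left multiplication by g
    also has a symmetric permutation matrix Q.  The edge directions i < j used
    to define the lift then become irrelevant for the constant signature g, and
    the adjacency matrix of G_g is the Kronecker product of the adjacency matrix
    of G with Q ([adjmx_const_lift]).

    Both factors are real symmetric, hence diagonalizable by the spectral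
    theorem.  If A and B are conjugate to diag(d) and diag(e), then their
    Kronecker product is conjugate, by the Kronecker product of the two
    conjugating matrices, to the diagonal matrix of the products d_i e_j.  The
    spectrum of the lift is therefore the multiset of products of an eigenvalue
    of G and an eigenvalue of Q ([spectrum_kron]), which depends on G only
    through its spectrum. *)

(** Unique factorization over [algC] makes the spectrum accessible through any
    splitting of the characteristic polynomial. *)
Lemma perm_spectrum m (A : 'M[algC]_m) (s : seq algC) :
  char_poly A = \prod_(z <- s) ('X - z%:P) -> perm_eq (spectrum A) s.
Proof.
move=> chA; apply: prod_XsubC_eq; rewrite -chA /spectrum.
case: closed_field_poly_normal => r /= Dr.
by rewrite [RHS]Dr (monicP (char_poly_monic A)) scale1r.
Qed.

(** Conjugation is stated with a one-sided inverse [P'] of [P], since this is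
    what [kronM] and [kron1] produce directly from those of the factors. *)
Lemma char_poly_conj (R : comNzRingType) m (P' P A : 'M[R]_m) :
  P' *m P = 1%:M -> char_poly (P' *m A *m P) = char_poly A.
Proof.
move=> P'P; rewrite /char_poly.
have P'P_X : map_mx polyC P' *m map_mx polyC P = 1%:M.
  by rewrite -map_mxM P'P map_mx1.
have -> : char_poly_mx (P' *m A *m P)
        = map_mx polyC P' *m char_poly_mx A *m map_mx polyC P.
  rewrite /char_poly_mx mulmxBr mulmxBl !map_mxM /=.
  by rewrite mul_mx_scalar -scalemxAl P'P_X scalemx1.
by rewrite !det_mulmx mulrAC -det_mulmx P'P_X det1 mul1r.
Qed.

Lemma spectrum_diag_conj m (P' P : 'M[algC]_m) (d : 'rV[algC]_m) :
  P' *m P = 1%:M ->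
  perm_eq (spectrum (P' *m diag_mx d *m P)) [seq d 0 i | i <- enum 'I_m].
Proof.
move=> P'P; apply: perm_spectrum; rewrite char_poly_conj //.
rewrite char_poly_trig ?diag_mx_is_trig // big_map big_enum /=.
by apply: eq_bigr => i _; rewrite mxE eqxx.
Qed.

Section Kronecker.

Variables S T : finType.

Definition split_rank (k : 'I_#|{: S * T}|) : 'I_#|S| * 'I_#|T| :=
  (enum_rank (enum_val k).1, enum_rank (enum_val k).2).

Lemma split_rank_bij : bijective split_rank.
Proof.
exists (fun p => enum_rank (enum_val p.1, enum_val p.2)) => [k | [i j]].
  by rewrite /= !enum_rankK -surjective_pairing enum_valK.
by rewrite /split_rank enum_rankK /= !enum_valK.
Qed.

Variable R : comNzRingType.
Implicit Types (A : 'M[R]_#|S|) (B : 'M[R]_#|T|).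

(** Rows and columns follow the enumeration of [S * T], as in the adjacency
    matrix of a graph whose vertices are pairs. *)
Definition kron A B : 'M[R]_#|{: S * T}| :=
  \matrix_(k, l) (A (split_rank k).1 (split_rank l).1
                * B (split_rank k).2 (split_rank l).2).

Lemma kronM A A' B B' : kron A B *m kron A' B' = kron (A *m A') (B *m B').
Proof.
apply/matrixP => k l; rewrite !mxE big_distrlr pair_big /=.
rewrite [RHS](reindex split_rank) /=; last exact/onW_bij/split_rank_bij.
by apply: eq_bigr => h _; rewrite !mxE mulrACA.
Qed.

Lemma kron_diag (d : 'rV[R]_#|S|) (e : 'rV[R]_#|T|) :
  kron (diag_mx d) (diag_mx e)
    = diag_mx (\row_k (d 0 (split_rank k).1 * e 0 (split_rank k).2)).
Proof.
apply/matrixP => k l; rewrite !mxE -(inj_eq (bij_inj split_rank_bij)).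
by rewrite -pair_eqE /pair_eq -mulnb mulrnA; do 2!case: eqP => _;
  rewrite ?mulr1n ?mulr0n ?mulr0 ?mul0r.
Qed.

Lemma kron1 : kron 1%:M 1%:M = 1%:M.
Proof.
rewrite -!diag_const_mx kron_diag; congr diag_mx.
by apply/rowP => k; rewrite !mxE mulr1.
Qed.

End Kronecker.

(** By multiplicativity of [kron], diagonalizations of the two factors combine
    into one of their Kronecker product; normality is what provides them. *)
Lemma spectrum_kron (S T : finType) (A : 'M[algC]_#|S|) (B : 'M[algC]_#|T|) :
  A \is normalmx -> B \is normalmx ->
  perm_eq (spectrum (kron A B))
          [seq a * b | a <- spectrum A, b <- spectrum B].
Proof.
move=> /orthomx_spectralP DA /orthomx_spectralP DB.
have VP := mulVmx (spectral_unit A); have VQ := mulVmx (spectral_unit B).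
move: VP VQ DA DB; set P' := invmx _; set P := spectralmx A.
set Q' := invmx _; set Q := spectralmx B => VP VQ DA DB.
have eqA := spectrum_diag_conj (spectral_diag A) VP; rewrite -DA in eqA.
have eqB := spectrum_diag_conj (spectral_diag B) VQ; rewrite -DB in eqB.
have VPQ : kron P' Q' *m kron P Q = 1%:M by rewrite kronM VP VQ kron1.
rewrite {1}DA {1}DB -!kronM kron_diag.
rewrite (permPl (spectrum_diag_conj _ VPQ)) perm_sym.
rewrite (permPl (perm_allpairs _ eqA eqB)).
apply: prod_XsubC_eq; rewrite big_allpairs_dep big_map [RHS]big_map !big_enum /=.
under eq_bigr do rewrite big_map big_enum /=.
rewrite pair_big /= (reindex (@split_rank S T)) /=.
  by apply: eq_bigr => k _; rewrite mxE.
exact/onW_bij/split_rank_bij.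
Qed.

Lemma adjmx_normal (T : finType) (G : sgraph T) : adjmx G \is normalmx.
Proof.
apply: symmetric_normalmx; last by apply/mxOverP => i j; rewrite mxE realn.
apply/is_hermitianmxP; rewrite scale1r map_mx_id //.
by apply/matrixP => i j; rewrite !mxE adj_sym.
Qed.

Section ConstantLift.

Variables (Gr : finGroupType) (t : nat) (elt : 'I_t -> Gr) (g : Gr).

(** The row of [1] in P_g has its one in column [g]; by symmetry the row of [g]
    has a one in column [1], which says that g * g = 1. *)
Lemma Pmx_sym_involution :
  bijective elt -> (Pmx elt g)^T = Pmx elt g -> (g * g = 1)%g.
Proof.
case=> idx _ idxK /matrixP/(_ (idx g) (idx 1%g)); rewrite !mxE !idxK mul1g eqxx.
by move=> /eqP; rewrite eqr_nat eq_sym eqb1 => /eqP.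
Qed.

Hypothesis gg1 : (g * g = 1)%g.

Lemma involution_mulg_eq (x y : Gr) : ((g * x)%g == y) = ((g * y)%g == x).
Proof. by apply/eqP/eqP => <-; rewrite mulgA gg1 mul1g. Qed.

(** An edge of the lift multiplies by [g] from the lower to the higher fibre and
    by the inverse of [g] on the way back; as [g] is its own inverse, the
    comparison of the two base vertices disappears. *)
Lemma const_lift_adjE n (G : sgraph 'I_n) x y :
  adj (const_lift elt G g) x y =
    adj G x.1 y.1 && ((g * elt x.2)%g == elt y.2).
Proof.
apply/existsP/andP => [[[p pE] /=] | [Gxy gxy]].
  rewrite inE in pE; case/andP: pE => _ Gp.
  case/orP=> /andP[/eqP Dp]; rewrite Dp /= in Gp; first by [].
  by rewrite adj_sym involution_mulg_eq.
case: (ltngtP x.1 y.1) => [lt_xy | lt_yx | /val_inj eq_xy].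
- have pE : (x.1, y.1) \in dotE G by rewrite inE lt_xy.
  by exists (exist (fun p => p \in dotE G) _ pE); rewrite /= eqxx gxy.
- have pE : (y.1, x.1) \in dotE G by rewrite inE lt_yx adj_sym.
  have gyx : ((g * elt y.2)%g == elt x.2) by rewrite involution_mulg_eq.
  by exists (exist (fun p => p \in dotE G) _ pE); rewrite /= eqxx gyx orbT.
- by rewrite eq_xy adj_irrefl in Gxy.
Qed.

(** Left multiplication by [g], in contrast with [Pmx]; the enumeration of
    ['I_t] indexes it so that it can be a factor of [kron]. *)
Definition lmul_mx : 'M[algC]_#|'I_t| :=
  \matrix_(a, b) ((g * elt (enum_val a))%g == elt (enum_val b))%:R.

Lemma lmul_mx_normal : lmul_mx \is normalmx.
Proof.
apply: symmetric_normalmx; last by apply/mxOverP => i j; rewrite mxE realn.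
apply/is_hermitianmxP; rewrite scale1r map_mx_id //.
by apply/matrixP => i j; rewrite !mxE involution_mulg_eq.
Qed.

Lemma adjmx_const_lift n (G : sgraph 'I_n) :
  adjmx (const_lift elt G g) = kron (adjmx G) lmul_mx.
Proof.
by apply/matrixP => k l; rewrite !mxE const_lift_adjE !enum_rankK -natrM mulnb.
Qed.

End ConstantLift.

Theorem lemma3 (n : nat) (G H : sgraph 'I_n)
  (Gr : finGroupType) (t : nat) (elt : 'I_t -> Gr) (elt_bij : bijective elt)
  (g : Gr) :
  cospectral G H ->
  (Pmx elt g)^T = Pmx elt g ->
  cospectral (const_lift elt G g) (const_lift elt H g).
Proof.
move=> GH /(Pmx_sym_involution elt_bij) gg1.
have Qnormal := lmul_mx_normal elt gg1.
rewrite /cospectral !adjmx_const_lift //.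
rewrite (permPl (spectrum_kron (adjmx_normal G) Qnormal)).
rewrite (permPr (spectrum_kron (adjmx_normal H) Qnormal)).
exact: perm_allpairs.
Qed.
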